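(* The set of Cremona coordinates of ascending $(d-2)$-flats that are $*$-transverse to a given $*$-box is convex.
   Context: All flats are flats in real projective space $\mathbb{RP}^d\supset\mathbb{R}^d$ that do not meet the origin of $\mathbb{R}^d$. Each hyperplane not containing the origin has a unique equation $a\cdot z=\sum_ia_iz_i=1$, where $z_1,\dots,z_d$ are the coordinates of $\mathbb{R}^d$; the coefficients $a=(a_1,\dots,a_d)$ are coordinates for the hyperplane, with $(0,\dots,0)$ giving the hyperplane at infinity. Such hyperplanes are partially ordered by componentwise comparison of these coordinates. The $*$-box between two hyperplanes $A\le B$ not containing the origin is the set of hyperplanes $H$ not containing the origin with $A\le H\le B$. A $(d-2)$-flat $K$ not meeting the origin is ascending if it is defined by equations $z\cdot x=1$ and $z\cdot v=0$, where each coordinate of $v$ is non-negative and $v\ne0$. The pair $(x,v)$ gives rectilinear coordinates for $K$. The hyperplanes containing $K$ and not the origin are $H_t=\{z: z\cdot(x+tv)=1\}$, $t\in\mathbb{R}$. The Cremona coordinates $(y,w)$ of $K$ are defined, for $i=1,\dots,d$, by $y_i=x_i/v_i$, $w_i=1/v_i$ if $v_i\ne0$, and $y_i=x_i$, $w_i=v_i=0$ if $v_i=0$; $y$ is regarded modulo translation by $(1,\dots,1)$ and $w$ modulo multiplication by a positive scalar, and these ambiguities are removed by requiring $\sum_iy_i=0$ and $\sum_iw_i=1$. An ascending $(d-2)$-flat is $*$-transverse to a $*$-box if it lies on some hyperplane $H$ in the $*$-box.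
   Formalization: Convexity is proved separately for each set of indices i with v_i ≠ 0 (equivalently w_i ≠ 0); over all ascending flats at once it fails, e.g. d=2, box from (0,0) to (1,1): (y,w)=((-1,1),(1,0)) and ((0,0),(0,1)) are in the set but their midpoint is not. *)

(* Defs.v *)
From mathcomp Require Import all_boot all_order all_algebra.
From mathcomp Require Import classical_sets reals convex.
Set Implicit Arguments.
Unset Strict Implicit.
Unset Printing Implicit Defensive.
Import Order.TTheory GRing.Theory Num.Theory.
Local Open Scope classical_set_scope.
Local Open Scope ring_scope.

(* RP^d is the set of lines of R^(1+d), with z in R^d embedded as the line    *)
(* of (1, z).  A flat of RP^d is a linear subspace K of R^(1+d), and its      *)
(* projective dimension is the linear dimension of K minus 1.                 *)
Definition hpoint (R : realType) (d : nat) (z0 : R) (z : 'rV[R]_d) :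
    'rV[R]_(1 + d) :=
  row_mx z0%:M z.

Definition flat (R : realType) (d k : nat) (K : {vspace 'rV[R]_(1 + d)}) :
    Prop :=
  \dim K = k.+1.

Definition avoids_origin (R : realType) (d : nat)
    (K : {vspace 'rV[R]_(1 + d)}) : Prop :=
  hpoint 1 0 \notin K.

Definition dotp (R : realType) (d : nat) (x z : 'rV[R]_d) : R :=
  \sum_(i < d) x 0 i * z 0 i.

(* H is the projective hyperplane with affine equation a . z = 1, homogenized *)
(* to a . z = z0; for a = 0 this is the hyperplane at infinity z0 = 0.        *)
Definition hyperplane_coords (R : realType) (d : nat)
    (H : {vspace 'rV[R]_(1 + d)}) (a : 'rV[R]_d) : Prop :=
  forall (z0 : R) (z : 'rV[R]_d), (hpoint z0 z \in H) = (dotp a z == z0).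

Definition origin_free_hyperplane (R : realType) (d : nat)
    (H : {vspace 'rV[R]_(1 + d)}) : Prop :=
  flat d.-1 H /\ avoids_origin H.

Definition hyperplane_le (R : realType) (d : nat)
    (A B : {vspace 'rV[R]_(1 + d)}) : Prop :=
  exists a b : 'rV[R]_d,
    [/\ hyperplane_coords A a, hyperplane_coords B b &
        forall i, a 0 i <= b 0 i].

Definition star_box (R : realType) (d : nat) (A B : {vspace 'rV[R]_(1 + d)}) :
    set {vspace 'rV[R]_(1 + d)} :=
  [set H | [/\ origin_free_hyperplane H, hyperplane_le A H &
               hyperplane_le H B]].

Definition rectilinear_coords (R : realType) (d : nat)
    (K : {vspace 'rV[R]_(1 + d)}) (x v : 'rV[R]_d) : Prop :=
  [/\ v != 0, forall i, 0 <= v 0 i &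
      forall (z0 : R) (z : 'rV[R]_d),
        (hpoint z0 z \in K) = (dotp z x == z0) && (dotp z v == 0)].

Definition ascending (R : realType) (d : nat) (K : {vspace 'rV[R]_(1 + d)}) :
    Prop :=
  [/\ flat (d - 2) K, avoids_origin K & exists x v, rectilinear_coords K x v].

Definition star_transverse (R : realType) (d : nat)
    (A B K : {vspace 'rV[R]_(1 + d)}) : Prop :=
  exists H, star_box A B H /\ (K <= H)%VS.

Definition cremona_y (R : realType) (d : nat) (x v : 'rV[R]_d) : 'rV[R]_d :=
  \row_i (if v 0 i == 0 then x 0 i else x 0 i / v 0 i).

Definition cremona_w (R : realType) (d : nat) (v : 'rV[R]_d) : 'rV[R]_d :=
  \row_i (if v 0 i == 0 then 0 else (v 0 i)^-1).

(* The rectilinear coordinates of K are unique up to x |-> x + t v and        *)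
(* v |-> c v with c > 0.  These changes translate y by t on the support of v, *)
(* resp. multiply w by 1/c (and y by 1/c on the support of v).  The two       *)
(* normalizations thus determine (x, v), and hence (y, w), from K.            *)
Definition cremona_coords (R : realType) (d : nat)
    (K : {vspace 'rV[R]_(1 + d)}) (c : 'rV[R]_d * 'rV[R]_d) : Prop :=
  exists x v : 'rV[R]_d,
    [/\ rectilinear_coords K x v, c = (cremona_y x v, cremona_w v),
        \sum_(i < d) c.1 0 i = 0 & \sum_(i < d) c.2 0 i = 1].

Definition cremona_transversals (R : realType) (d : nat)
    (A B : {vspace 'rV[R]_(1 + d)}) : set ('rV[R]_d * 'rV[R]_d) :=
  [set c | exists K,
     [/\ ascending K, star_transverse A B K & cremona_coords K c]].

(* The i-th Cremona coordinates have a different meaning according to whether *)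
(* v_i = 0 (y_i = x_i) or v_i != 0 (y_i = x_i / v_i), so the coordinates live *)
(* on the disjoint union of the strata given by the support of v, which is    *)
(* also the support of w.  Convexity is meaningful stratum by stratum: for    *)
(* d = 2 and the box between (0, 0) and (1, 1), the pairs                     *)
(* (y, w) = ((-1, 1), (1, 0)) and (y, w) = ((0, 0), (0, 1)), from different   *)
(* strata, belong to cremona_transversals, but their midpoint does not.       *)
Definition cremona_stratum (R : realType) (d : nat) (S : {set 'I_d}) :
    set ('rV[R]_d * 'rV[R]_d) :=
  [set c : 'rV[R]_d * 'rV[R]_d | forall i, (c.2 0 i != 0) = (i \in S)].

(* Main.v *)
(* The flat K with rectilinear coordinates (x, v) lies in a hyperplane of the *)
(* box [a, b] iff a <= x + t v <= b for some t.  Multiplying the i-th         *)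
(* inequality by w_i = 1/v_i when v_i != 0 turns this into                    *)
(* a_i w_i <= y_i + t <= b_i w_i, and into a_i <= y_i <= b_i when v_i = 0.    *)
(* On a fixed stratum these conditions are linear in (y, w, t), so the        *)
(* transversals form the projection of a convex set along t.                  *)
Require Import Defs.
From mathcomp Require Import all_boot all_order all_algebra.
From mathcomp Require Import classical_sets reals convex.
From mathcomp Require Import interval_inference ring lra.
Set Implicit Arguments.
Unset Strict Implicit.
Unset Printing Implicit Defensive.
Import Order.TTheory GRing.Theory Num.Theory.
Local Open Scope classical_set_scope.
Local Open Scope ring_scope.

(** The pairs [(y, w)] of a fixed stratum that come from transversal flats are cut out, by
    [cremona_transversalsP], by conditions that are affine in [y], [w] and one auxiliary real [t],
    where the hyperplane through the flat has coordinates [x + t *: v]. So a convex combination of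
    two solutions, taken with the same weights on [t], is again a solution, and the stratum is
    preserved because entries of [w] on its support are positive. The translation to linear
    conditions rests on [rectilinear_sub_hyperplane], which describes the hyperplanes through a
    flat. Its converse direction needs actual subspaces with prescribed coordinates;
    [ex_hyperplane_coords] and [ex_rectilinear_coords] build them as kernels. *)

Lemma dotpC (R : realType) (d : nat) (x z : 'rV[R]_d) : dotp x z = dotp z x.
Proof. by apply: eq_bigr => i _; rewrite mulrC. Qed.

Lemma dotpDl (R : realType) (d : nat) (x y z : 'rV[R]_d) :
  dotp (x + y) z = dotp x z + dotp y z.
Proof.
by rewrite /dotp -big_split; apply: eq_bigr => i _; rewrite mxE mulrDl.
Qed.

Lemma dotpZl (R : realType) (d : nat) (k : R) (x z : 'rV[R]_d) :
  dotp (k *: x) z = k * dotp x z.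
Proof.
by rewrite /dotp mulr_sumr; apply: eq_bigr => i _; rewrite mxE mulrA.
Qed.

Lemma dotp0l (R : realType) (d : nat) (z : 'rV[R]_d) : dotp 0 z = 0.
Proof. by rewrite -(scale0r 0) dotpZl mul0r. Qed.

Lemma dotp_delta (R : realType) (d : nat) (x : 'rV[R]_d) (i : 'I_d) :
  dotp (delta_mx 0 i) x = x 0 i.
Proof.
rewrite /dotp (bigD1 i) //= mxE !eqxx mul1r big1 ?addr0 // => j jNi.
by rewrite mxE (negbTE jNi) andbF mul0r.
Qed.

Lemma mulmx_tr_dotp (R : realType) (d : nat) (z x : 'rV[R]_d) :
  z *m x^T = (dotp z x)%:M.
Proof.
apply/matrixP => i j; rewrite !ord1 !mxE eqxx mulr1n.
by apply: eq_bigr => k _; rewrite mxE.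
Qed.

Lemma hpoint_submx (R : realType) (d : nat) (u : 'rV[R]_(1 + d)) :
  u = hpoint (lsubmx u 0 0) (rsubmx u).
Proof. by rewrite /hpoint -mx11_scalar hsubmxK. Qed.

(** Rank-nullity, in the form that gives the dimension of a flat defined by independent
    equations. *)
Lemma dim_lker_surj (K : fieldType) (aT rT : vectType K) (f : 'Hom(aT, rT)) :
  (forall y, exists x, f x = y) -> (\dim (lker f) + dim rT = dim aT)%N.
Proof.
move=> f_surj; rewrite -!dimvf -(limg_ker_dim f fullv) capfv; congr addn.
congr (\dim _); apply/esym/eqP; rewrite eqEsubv subvf; apply/subvP => y _.
by have [x <-] := f_surj y; apply: memv_img; rewrite memvf.
Qed.

Lemma mem_lker_mulmxr (K : fieldType) (m n : nat) (M : 'M[K]_(m, n))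
    (u : 'rV[K]_m) :
  (u \in lker (linfun (mulmxr M))) = (u *m M == 0).
Proof. by rewrite memv_ker lfunE. Qed.

Lemma dim_lker_mulmxr (K : fieldType) (m n : nat) (M : 'M[K]_(m, n)) :
  (forall y : 'rV_n, exists x : 'rV_m, x *m M = y) ->
  (\dim (lker (linfun (mulmxr M : 'rV_m -> 'rV_n))) + n = m)%N.
Proof.
move=> M_surj.
have := @dim_lker_surj _ _ _ (linfun (mulmxr M : 'rV_m -> 'rV_n)).
rewrite !dim_matrix !mul1r; apply => y.
by have [x xM] := M_surj y; exists x; rewrite lfunE.
Qed.

Lemma ex_hyperplane_coords (R : realType) (d : nat) (d_gt0 : (0 < d)%N)
    (h : 'rV[R]_d) :
  exists2 H, origin_free_hyperplane H & hyperplane_coords H h.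
Proof.
pose M : 'M[R]_(1 + d, 1) := col_mx (- 1)%:M h^T.
have hpointM z0 z : hpoint z0 z *m M = (dotp h z - z0)%:M.
  rewrite mul_row_col -scalar_mxM mulmx_tr_dotp -raddfD /= dotpC.
  by rewrite mulrN1 addrC.
have HE : hyperplane_coords (lker (linfun (mulmxr M))) h.
  by move=> z0 z; rewrite mem_lker_mulmxr hpointM fmorph_eq0 subr_eq0.
exists (lker (linfun (mulmxr M))) => //; split.
  rewrite /flat prednK //; apply/eqP; rewrite -(eqn_add2r 1).
  rewrite dim_lker_mulmxr 1?addnC //.
  move=> y; exists (hpoint (- y 0 0) 0).
  by rewrite hpointM [RHS]mx11_scalar opprK dotpC dotp0l add0r.
by rewrite /avoids_origin HE dotpC dotp0l eq_sym oner_eq0.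
Qed.

(** The flat is the common kernel of the functionals with columns [(-1, x)] and [(0, v)]. They are
    independent since [v] is nonzero, so the kernel has dimension [d - 1]. *)
Lemma ex_rectilinear_coords (R : realType) (d : nat) (d_gt1 : (1 < d)%N)
    (x v : 'rV[R]_d) :
  v != 0 -> (forall i, 0 <= v 0 i) ->
  exists2 K, ascending K & rectilinear_coords K x v.
Proof.
move=> v_neq0 v_ge0.
pose M : 'M[R]_(1 + d, 1 + 1) :=
  row_mx (col_mx (- 1)%:M x^T) (col_mx 0 v^T).
have hpointM z0 z : hpoint z0 z *m M = row_mx (dotp z x - z0)%:M (dotp z v)%:M.
  rewrite mul_mx_row !mul_row_col -scalar_mxM !mulmx_tr_dotp mulmx0 add0r.
  by rewrite -raddfD /= mulrN1 addrC.
pose K := lker (linfun (mulmxr M : 'rV_(1 + d) -> 'rV_(1 + 1))).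
have KE : rectilinear_coords K x v.
  split=> // z0 z; rewrite mem_lker_mulmxr hpointM -[dotp z x == _]subr_eq0.
  rewrite -row_mx0 -!(fmorph_eq0 (@scalar_mx R 1)).
  by apply/eqP/andP => [/eq_row_mx[/eqP ? /eqP]|[/eqP-> /eqP->]].
exists K => //; split.
- rewrite /flat; apply/eqP; rewrite -(eqn_add2r (1 + 1)).
  have /rV0Pn[i vi_neq0] := v_neq0.
  rewrite dim_lker_mulmxr; first by rewrite -[in eqbLHS](subnK d_gt1).
  (* Surjectivity: a multiple of the [i]-th basis vector reaches any value of the second functional,
     and the free coordinate [z0] then adjusts the first. *)
  move=> y; set z := (rsubmx y 0 0 / v 0 i) *: (delta_mx 0 i : 'rV_d).
  exists (hpoint (dotp z x - lsubmx y 0 0) z).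
  rewrite hpointM subKr dotpZl dotp_delta mulfVK //.
  by rewrite -!mx11_scalar hsubmxK.
- by have [_ _ memK] := KE;
    rewrite /avoids_origin memK dotp0l eq_sym oner_eq0.
- by exists x, v.
Qed.

(** The point with [z0 = a 0 i] and [z] the [i]-th basis vector lies on [H], so the equation of [b]
    holds there. *)
Lemma hyperplane_coords_inj (R : realType) (d : nat)
    (H : {vspace 'rV[R]_(1 + d)}) (a b : 'rV[R]_d) :
  hyperplane_coords H a -> hyperplane_coords H b -> a = b.
Proof.
move=> Ha Hb; apply/rowP => i.
have := Ha (a 0 i) (delta_mx 0 i).
by rewrite Hb ![dotp _ (delta_mx 0 i)]dotpC !dotp_delta eqxx => /eqP.
Qed.

Lemma rectilinear_sub_hyperplane (R : realType) (d : nat)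
    (K H : {vspace 'rV[R]_(1 + d)}) (x v h : 'rV[R]_d) :
  rectilinear_coords K x v -> hyperplane_coords H h ->
  (K <= H)%VS <-> exists t, h = x + t *: v.
Proof.
move=> [v_neq0 _ KE] HE; split=> [/subvP KH|[t hE]]; last first.
  rewrite {}hE in HE; apply/subvP => u.
  rewrite (hpoint_submx u) KE HE => /andP[/eqP zx /eqP zv].
  by rewrite dotpDl dotpZl 2![dotp _ (rsubmx u)]dotpC zx zv mulr0 addr0.
have /rV0Pn[i vi_neq0] := v_neq0.
exists ((h 0 i - x 0 i) / v 0 i); apply/rowP => j; rewrite !mxE.
(* This [z] is orthogonal to [v], so it lifts to a point of [K]. On it the two equations agree,
   whence [v_i (h_j - x_j) = v_j (h_i - x_i)]: [h - x] is proportional to [v]. *)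
pose z : 'rV[R]_d := v 0 i *: delta_mx 0 j + (- v 0 j) *: delta_mx 0 i.
have dotz u : dotp z u = v 0 i * u 0 j - v 0 j * u 0 i.
  by rewrite dotpDl !dotpZl !dotp_delta mulNr.
have /KH : hpoint (dotp z x) z \in K.
  by rewrite KE eqxx dotz mulrC subrr eqxx.
rewrite HE dotpC !dotz => /eqP hx.
apply: (mulfI vi_neq0); rewrite mulrDr mulrA [v 0 i * (_ / _)]mulrC mulfVK //.
lra.
Qed.

(** The factor [k] and the indicator on [t] merge the two shapes of the inequalities, on and off the
    support, into one that is affine in [(y, w, t)] once [S] is fixed. *)
Lemma cremona_transversalsP (R : realType) (d : nat) (d_gt1 : (1 < d)%N)
    (A B : {vspace 'rV[R]_(1 + d)}) (a b : 'rV[R]_d) (S : {set 'I_d})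
    (y w : 'rV[R]_d) :
  hyperplane_coords A a -> hyperplane_coords B b ->
  cremona_stratum S (y, w) ->
  cremona_transversals A B (y, w) <->
  [/\ \sum_i y 0 i = 0, \sum_i w 0 i = 1, forall i, 0 <= w 0 i &
      exists t, forall i,
        let k := if i \in S then w 0 i else 1 in
        a 0 i * k <= y 0 i + t * (i \in S)%:R <= b 0 i * k].
Proof.
move=> HA HB wS; split.
  move=> [K [_ [H [[_ [a' [h [HA' Hh ah]]] [h' [b' [Hh' HB' hb]]]] KH]]]].
  move=> [x [v [Kxv [yE wE] /= y0 w1]]].
  rewrite -(hyperplane_coords_inj HA HA') in ah.
  rewrite -(hyperplane_coords_inj HB HB') -(hyperplane_coords_inj Hh Hh') in hb.
  have [t hE] := (rectilinear_sub_hyperplane Kxv Hh).1 KH.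
  have [_ v_ge0 _] := Kxv.
  split=> // [i|]; first by rewrite wE mxE; case: ifP => //; rewrite invr_ge0.
  exists t => i /=; have := ah i; have := hb i.
  rewrite -(wS i) /= yE wE hE !mxE.
  case: (eqVneq (v 0 i) 0) => [->|vi_neq0]; rewrite ?eqxx /=.
    by rewrite !mulr0 !mulr1 !addr0 => -> ->.
  have vi_gt0 : 0 < v 0 i by rewrite lt0r vi_neq0 v_ge0.
  rewrite invr_eq0 vi_neq0 mulr1 => hbi ahi.
  have -> : x 0 i / v 0 i + t = (x 0 i + t * v 0 i) / v 0 i.
    by rewrite mulrDl mulfK.
  by rewrite !ler_pM2r ?invr_gt0 // ahi.
move=> [y0 w1 w_ge0 [t yt]].
(* The Cremona map is inverted. Since [0^-1 = 0], the formula for [v] also covers the entries off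
   the support; there [x] equals [y]. *)
pose v : 'rV[R]_d := \row_i (w 0 i)^-1.
pose x : 'rV[R]_d := \row_i (y 0 i / (if w 0 i == 0 then 1 else w 0 i)).
(* If [v] vanished, so would [w], whose entries sum to 1. *)
have v_neq0 : v != 0.
  apply/eqP => /rowP v0; move/eqP: w1.
  rewrite big1 1?eq_sym ?oner_eq0 // => i _.
  by have /eqP := v0 i; rewrite !mxE invr_eq0 => /eqP.
have v_ge0 i : 0 <= v 0 i by rewrite mxE invr_ge0.
have [K Kasc Kxv] := @ex_rectilinear_coords _ _ d_gt1 x v v_neq0 v_ge0.
have [H Hfree Hh] := @ex_hyperplane_coords _ _ (ltnW d_gt1) (x + t *: v).
have vxt i : a 0 i <= x 0 i + t * v 0 i <= b 0 i.
  have := yt i; rewrite -(wS i) !mxE /=.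
  case: (eqVneq (w 0 i) 0) => [->|wi_neq0] /=.
    by rewrite !mulr1 invr1 invr0 !mulr0 mulr1.
  have wi_gt0 : 0 < w 0 i by rewrite lt0r wi_neq0 w_ge0.
  by rewrite mulr1 -mulrDl ler_pdivlMr // ler_pdivrMr.
exists K; split => //.
  exists H; split; last by apply/(rectilinear_sub_hyperplane Kxv Hh); exists t.
  split=> //; [exists a, (x + t *: v)|exists (x + t *: v), b]; split=> // i;
    by rewrite mxE [X in _ + X]mxE; case/andP: (vxt i).
exists x, v; split=> //; congr pair; apply/rowP => i; rewrite !mxE invr_eq0.
  by case: (eqVneq (w 0 i) 0) => [_|wi_neq0]; rewrite ?divr1 // invrK mulfVK.
by case: (eqVneq (w 0 i) 0) => [->|_]; rewrite ?invrK.
Qed.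

Theorem theorem21 (R : realType) (d : nat) (hd : (2 <= d)%N)
    (A B : {vspace 'rV[R]_(1 + d)})
    (hA : origin_free_hyperplane A) (hB : origin_free_hyperplane B)
    (hAB : hyperplane_le A B) (S : {set 'I_d}) :
  convex_set (cremona_transversals A B `&` cremona_stratum S).
Proof.
have [a [b [HA HB _]]] := hAB.
move=> [y1 w1] [y2 w2] l; rewrite !inE.
move=> [/[swap] wS1 /(cremona_transversalsP hd HA HB wS1)].
move=> [y10 w11 w1_ge0 [t1 yt1]].
move=> [/[swap] wS2 /(cremona_transversalsP hd HA HB wS2)].
move=> [y20 w21 w2_ge0 [t2 yt2]].
have p_ge0 : 0 <= l%:num :> R by exact: ge0.
have q_ge0 : 0 <= 1 - l%:num :> R by rewrite subr_ge0; exact: le1.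
set p := l%:num in p_ge0 q_ge0; set q := 1 - p in q_ge0.
have pq1 : p + q = 1 by rewrite subrKC.
change ((cremona_transversals A B `&` cremona_stratum S)
  (p *: y1 + q *: y2, p *: w1 + q *: w2)).
move: p q p_ge0 q_ge0 pq1 => {l} p q p_ge0 q_ge0 pq1.
(* Off [S] both entries of [w] vanish. On [S] both are positive, and the weights are non-negative
   with sum 1, so no cancellation occurs. *)
have wS : cremona_stratum S (p *: y1 + q *: y2, p *: w1 + q *: w2).
  move=> i; move: (wS1 i) (wS2 i); rewrite /= !mxE.
  case: (i \in S) => [w1i w2i|/eqP-> /eqP->]; last first.
    by rewrite !mulr0 addr0 eqxx.
  have w1i_gt0 : 0 < w1 0 i by rewrite lt0r w1i w1_ge0.
  have w2i_gt0 : 0 < w2 0 i by rewrite lt0r w2i w2_ge0.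
  apply: lt0r_neq0; have [p0|p_neq0] := eqVneq p 0.
    by move: pq1; rewrite p0 add0r => ->; rewrite mul0r add0r mul1r.
  by rewrite ltr_pwDl ?mulr_ge0 ?mulr_gt0 // lt0r p_neq0.
split=> //; apply/(cremona_transversalsP hd HA HB wS); split.
- under eq_bigr do rewrite mxE mxE [X in _ + X]mxE.
  by rewrite big_split -!mulr_sumr /= y10 y20 !mulr0 addr0.
- under eq_bigr do rewrite mxE mxE [X in _ + X]mxE.
  by rewrite big_split -!mulr_sumr /= w11 w21 !mulr1.
- by move=> i; rewrite !mxE addr_ge0 ?mulr_ge0.
(* The parameter is combined with the same weights; each bound is then [p] times the first plus [q]
   times the second. *)
exists (p * t1 + q * t2) => i; move: (yt1 i) (yt2 i); rewrite !mxE.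
case: (i \in S) => /= /andP[a1 b1] /andP[a2 b2]; apply/andP; split; nra.
Qed.
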